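(* Let $k$ be a field and $\Lambda=k[X,Z_0,Z_1,Z_2,\dots]$ the polynomial ring in countably many variables. Let $\Omega=\Lambda/\big(X^{2^i}Z_{i+1}+Z_i+Z_{i-1}^2\big)_{i\ge1}=k[x,z_0,z_1,\dots]$, where $x,z_i$ are the images of $X,Z_i$, and let $\mathfrak{m}=(x,z_0)\subset\Omega$. Then $\dim\Omega=3$ and $\mathrm{ht}(\mathfrak{m})=3$. Consequently, $\Omega$ is not noetherian. *)

(* Defs.v *)
From HB Require Import structures.
From mathcomp Require Import all_boot all_order all_algebra.
From mathcomp.multinomials Require Import monalg.

Set Implicit Arguments.
Unset Strict Implicit.
Unset Printing Implicit Defensive.

Import GRing.Theory.
Local Open Scope ring_scope.

Section CommAlg.
Variable R : comRingType.

Definition subset_pred (A B : R -> Prop) := forall x, A x -> B x.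

Definition is_ideal (A : R -> Prop) :=
  [/\ A 0, (forall x y, A x -> A y -> A (x + y)) & (forall r x, A x -> A (r * x))].

Definition is_prime (P : R -> Prop) :=
  [/\ is_ideal P, ~ P 1 & (forall x y, P (x * y) -> P x \/ P y)].

Definition ideal_gen (G : R -> Prop) (x : R) :=
  forall A, is_ideal A -> subset_pred G A -> A x.

(* Working in the quotient R/J: ideals (resp. primes) of R/J are identified
   with ideals (resp. primes) of R containing J. *)
Definition is_prime_quot (J P : R -> Prop) := is_prime P /\ subset_pred J P.

Definition prime_chain_quot (J : R -> Prop) (n : nat) (P : nat -> R -> Prop) :=
  (forall i, (i <= n)%N -> is_prime_quot J (P i)) /\
  (forall i, (i < n)%N ->
     subset_pred (P i) (P i.+1) /\ exists x, P i.+1 x /\ ~ P i x).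

Definition krull_dim_quot (J : R -> Prop) (d : nat) :=
  (exists P, prime_chain_quot J d P) /\ ~ (exists P, prime_chain_quot J d.+1 P).

Definition chain_below (J Q : R -> Prop) (n : nat) :=
  exists P, prime_chain_quot J n P /\ (forall x, P n x <-> Q x).

(* height of the ideal M of R/J (M an ideal of R containing J) equals h:
   ht M = min { ht Q | Q prime of R/J containing M },
   ht Q = sup { lengths of chains of primes of R/J ending at Q } *)
Definition ideal_height_quot (J M : R -> Prop) (h : nat) :=
  (forall Q, is_prime_quot J Q -> subset_pred M Q -> chain_below J Q h) /\
  (exists Q, [/\ is_prime_quot J Q, subset_pred M Q & ~ chain_below J Q h.+1]).

Definition noetherian_quot (J : R -> Prop) :=
  forall A : nat -> R -> Prop,
    (forall n, is_ideal (A n) /\ subset_pred J (A n)) ->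
    (forall n, subset_pred (A n) (A n.+1)) ->
    exists N, forall m, (N <= m)%N -> forall x, A m x <-> A N x.

End CommAlg.

Unset Implicit Arguments.
Definition Lambda (k : fieldType) := {malg k[{cmonom (option nat)}]}.

Definition varX (k : fieldType) : Lambda k := << ucm (None : option nat) >>.
Definition varZ (k : fieldType) (i : nat) : Lambda k := << ucm (Some i) >>.

Definition rel_Omega (k : fieldType) (i : nat) : Lambda k :=
  varX k ^+ (2 ^ i) * varZ k i.+1 + varZ k i + varZ k i.-1 ^+ 2.

Definition J_Omega (k : fieldType) : Lambda k -> Prop :=
  ideal_gen (fun f => exists i, (1 <= i)%N /\ f = rel_Omega k i).

(* preimage in Lambda of the ideal m = (x, z_0) of Omega *)
Definition m_Omega (k : fieldType) : Lambda k -> Prop :=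
  ideal_gen (fun f => (exists i, (1 <= i)%N /\ f = rel_Omega k i)
                      \/ f = varX k \/ f = varZ k 0).

(* Main.v *)
(** A chain of [n + 1] primes of [Omega] yields [n] elements algebraically
   independent modulo its smallest prime [P]. If [x] is not in [P], then modulo
   [P] and up to powers of [x] everything is a polynomial in [x, z_0, z_1]; if
   [x] is in [P], then [z_(i+1) = - z_i ^ 2] modulo [P]. In both cases a dimension
   count excludes four independent elements, so [dim Omega <= 3].

   For the lower bounds, inverting [x] gives a map
   [sigma : Omega -> k(x)[z_1][z_0]], and the kernels of [sigma], of [sigma] at
   [z_0 = 0] and of [sigma] at [z_0 = z_1 = 0] form a chain of primes below any
   prime containing [(x, z_0)].

   At first order in [z_1] along [z_0 = 0], the relations read
   [x ^ (2 ^ i) z_(i+1) = - z_i], so the linear coefficients of the [z_i] have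
   poles of unbounded order at [x = 0]; bounding the order of the pole by [n]
   defines an ascending sequence of ideals that never stabilises. *)
Require Import Defs.
From HB Require Import structures.
From mathcomp Require Import all_boot all_order all_algebra finmap.
From mathcomp.multinomials Require Import monalg.
From Stdlib Require Import Classical.

Set Implicit Arguments.
Unset Strict Implicit.
Unset Printing Implicit Defensive.

Import GRing.Theory.
Local Open Scope ring_scope.

(** * Ideals and primes of a commutative ring *)

Section Ideals.
Variable R : comRingType.
Implicit Types A P Q : R -> Prop.

Lemma idealN A x : is_ideal A -> A x -> A (- x).
Proof. by move=> [_ _ AM] Ax; rewrite -mulN1r; apply: AM. Qed.

Lemma idealB A x y : is_ideal A -> A x -> A y -> A (x - y).
Proof. by move=> iA Ax Ay; case: (iA) => _ AD _; apply: AD => //; apply: idealN. Qed.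

Lemma idealDr A x y : is_ideal A -> A y -> A (x + y) -> A x.
Proof. by move=> iA Ay Axy; rewrite -(addrK y x); apply: idealB. Qed.

Lemma ideal_sum A (I : finType) (F : I -> R) :
  is_ideal A -> (forall i, A (F i)) -> A (\sum_i F i).
Proof. by move=> [A0 AD _] AF; apply: big_ind => // i _. Qed.

Lemma prime_exp P x n : is_prime P -> P (x ^+ n) -> P x.
Proof.
move=> [_ P1 PM]; elim: n => [/P1 //|n IHn].
by rewrite exprS => /PM [].
Qed.

Lemma ideal_gen_sub (G A : R -> Prop) :
  is_ideal A -> subset_pred G A -> subset_pred (ideal_gen G) A.
Proof. by move=> iA GA x; apply. Qed.

Lemma sub_ideal_gen (G : R -> Prop) : subset_pred G (ideal_gen G).
Proof. by move=> x Gx A _; apply. Qed.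

(* If b lies in Q but not in P, dividing the relation p.[b] in P by a power
   of b exposes the constant coefficient, which lies in Q. *)
Lemma horner_prime_eq0 P Q (b : R) (p : {poly R}) :
    is_prime P -> is_ideal Q -> subset_pred P Q -> Q b -> ~ P b ->
  (forall i, Q p`_i -> p`_i = 0) -> P p.[b] -> p = 0.
Proof.
move=> [iP _ PM] iQ PQ Qb Pb; elim/poly_ind: p => [//|p c IHp] coef0.
rewrite hornerMXaddC => Ppb; have c0 : c = 0.
  have := coef0 0%N; rewrite coefD coefMX coefC /= add0r; apply.
  apply: (@idealDr Q _ (p.[b] * b)) => //; last by rewrite addrC; apply: PQ.
  by case: iQ => _ _; apply.
move: coef0 Ppb; rewrite {}c0 !addr0 => coef0 /PM [Ppb|//].
rewrite IHp ?mul0r ?addr0 // => i; have := coef0 i.+1.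
by rewrite coefMX.
Qed.

End Ideals.

(** * Algebraic independence modulo a prime and the dimension count *)

Section Independence.
Variables (k : fieldType) (R : comAlgType k).
Implicit Types (A P Q : R -> Prop) (v : nat -> R) (r m n : nat).

Lemma idealZ A c x : is_ideal A -> A x -> A (c *: x).
Proof. by move=> [_ _ AM] Ax; rewrite -mulr_algl; apply: AM. Qed.

(** The matrix [M] has more rows than columns, so a nonzero row vector [c] kills it from the left;
    the combination of the [a i] then equals that of the differences [a i - \sum_j M i j *: w j]. *)
Lemma linear_relation_mod A (I J : finType) (a : I -> R) (w : J -> R)
    (M : I -> J -> k) :
    is_ideal A -> (#|J| < #|I|)%N ->
    (forall i, A (a i - \sum_j M i j *: w j)) ->
  exists c : I -> k, (exists i, c i != 0) /\ A (\sum_i c i *: a i).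
Proof.
move=> iA ltJI aM.
pose B : 'M_(#|I|, #|J|) := \matrix_(i, j) M (enum_val i) (enum_val j).
pose u := nz_row (kermx B).
have u_neq0 : u != 0.
  rewrite nz_row_eq0 -mxrank_eq0 mxrank_ker subn_eq0 -ltnNge.
  exact: leq_ltn_trans (rank_leq_col B) ltJI.
have uB : u *m B = 0 by apply/sub_kermxP/nz_row_sub.
exists (fun i => u 0 (enum_rank i)); split.
  by have /rV0Pn [i ui] := u_neq0; exists (enum_val i); rewrite enum_valK.
have -> : \sum_i u 0 (enum_rank i) *: a i =
    \sum_i u 0 (enum_rank i) *: (a i - \sum_j M i j *: w j).
  transitivity (\sum_i u 0 (enum_rank i) *: a i -
      \sum_i u 0 (enum_rank i) *: (\sum_j M i j *: w j)); last first.
    by rewrite -sumrB; apply: eq_bigr => i _; rewrite scalerBr.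
  rewrite [X in _ - X](_ : _ = 0) ?subr0 //.
  under eq_bigr do rewrite scaler_sumr.
  rewrite exchange_big big1 //= => j _.
  under eq_bigr do rewrite scalerA.
  have uBj : \sum_i u 0 (enum_rank i) * M i j = 0.
    have /matrixP/(_ 0 (enum_rank j)) := uB; rewrite !mxE => uBj; rewrite -[RHS]uBj.
    rewrite (reindex (@enum_val I I)) /=; last first.
      by exists enum_rank => i _; rewrite ?enum_rankK ?enum_valK.
    by apply: eq_bigr => i _; rewrite mxE enum_valK enum_rankK.
  by rewrite -scaler_suml uBj scale0r.
by apply: ideal_sum => // i; apply: idealZ.
Qed.

(** Exponent vectors as nested pairs, so that recursion on [r] splits off the last variable
    [v r.-1]. *)
Fixpoint expo m r : finType :=
  if r is r'.+1 then ('I_m.+1 * expo m r')%type : finType else unit : finType.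

Fixpoint monom v m r : expo m r -> R :=
  match r return expo m r -> R with
  | 0 => fun _ => 1
  | r'.+1 => fun e => v r' ^+ e.1 * monom v e.2
  end.

Lemma card_expo m r : #|expo m r| = (m.+1 ^ r)%N.
Proof. by elim: r => [|r IHr] /=; rewrite ?card_unit // card_prod card_ord IHr expnS. Qed.

Lemma eq_monom v v' m r (e : expo m r) :
  (forall i, (i < r)%N -> v i = v' i) -> monom v e = monom v' e.
Proof.
elim: r e => [//|r IHr] [i e] /= eqv; rewrite eqv // IHr // => j ltjr.
by apply: eqv; apply: ltnW.
Qed.

Definition poly_le v r m (f : R) :=
  exists c : expo m r -> k, f = \sum_e c e *: monom v e.

(** Every polynomial has bounded exponents, so quantifying over [m] gives algebraic independence
    over [k] of the images of [v 0, .., v r.-1] modulo [P]. *)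
Definition indep_mod P v r :=
  forall m (c : expo m r -> k), P (\sum_e c e *: monom v e) -> forall e, c e = 0.

Lemma poly_le0 v r m : poly_le v r m 0.
Proof. by exists (fun=> 0); rewrite big1 // => e _; rewrite scale0r. Qed.

Lemma poly_leD v r m f g : poly_le v r m f -> poly_le v r m g -> poly_le v r m (f + g).
Proof.
move=> [c ->] [c' ->]; exists (fun e => c e + c' e).
by rewrite -big_split; apply: eq_bigr => e _; rewrite scalerDl.
Qed.

Lemma poly_leZ v r m a f : poly_le v r m f -> poly_le v r m (a *: f).
Proof.
move=> [c ->]; exists (fun e => a * c e).
by rewrite scaler_sumr; apply: eq_bigr => e _; rewrite scalerA.
Qed.

Lemma poly_le_sum v r m (I : finType) (F : I -> R) :
  (forall i, poly_le v r m (F i)) -> poly_le v r m (\sum_i F i).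
Proof.
move=> leF; apply: big_ind => // [|f g]; [exact: poly_le0 | exact: poly_leD].
Qed.

Lemma poly_le_monom v r m (e : expo m r) : poly_le v r m (monom v e).
Proof.
exists (fun e' => (e' == e)%:R); rewrite (bigD1 e) //= eqxx scale1r.
by rewrite big1 ?addr0 // => e' /negbTE ->; rewrite scale0r.
Qed.

Lemma monomM v r m m' (e : expo m r) (e' : expo m' r) :
  exists e'' : expo (m + m') r, monom v e'' = monom v e * monom v e'.
Proof.
elim: r e e' => [|r IHr] /= => [_ _|[i e] [j e']]; first by exists tt; rewrite mulr1.
have [e'' def_e''] := IHr e e'.
exists (inord (i + j), e''); rewrite /= inordK.
  by rewrite def_e'' exprD mulrACA.
by rewrite ltnS leq_add // -ltnS ltn_ord.
Qed.

Lemma poly_leM v r m m' f g :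
  poly_le v r m f -> poly_le v r m' g -> poly_le v r (m + m') (f * g).
Proof.
move=> [c ->] [c' ->]; rewrite mulr_suml; apply: poly_le_sum => e.
rewrite mulr_sumr; apply: poly_le_sum => e'.
rewrite -scalerAl -scalerAr; do 2!apply: poly_leZ.
by have [e'' <-] := monomM v e e'; apply: poly_le_monom.
Qed.

Lemma poly_le1 v r m : poly_le v r m 1.
Proof.
suff [e <-] : exists e : expo m r, monom v e = 1 by apply: poly_le_monom.
elim: r => [|r [e def_e]]; first by exists tt.
by exists (ord0, e); rewrite /= def_e mulr1.
Qed.

Lemma poly_leC v r m c : poly_le v r m c%:A.
Proof. exact/poly_leZ/poly_le1. Qed.

Lemma poly_le_var v r m i : (i < r)%N -> poly_le v r m.+1 (v i).
Proof.
move=> ltir; suff [e <-] : exists e : expo m.+1 r, monom v e = v i.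
  exact: poly_le_monom.
elim: r ltir => [//|r IHr]; rewrite ltnS leq_eqVlt => /orP[/eqP-> | /IHr [e def_e]].
  have [e def_e] : exists e : expo m.+1 r, monom v e = 1.
    elim: (r) => [|s [e def_e]]; first by exists tt.
    by exists (ord0, e); rewrite /= def_e mulr1.
  by exists (inord 1, e); rewrite /= def_e inordK // mulr1.
by exists (ord0, e); rewrite /= def_e mul1r.
Qed.

(* [d ^+ m * f] is congruent mod [P] to a polynomial of degree at most [2 m] in
   each of [v 0, .., v r.-1]; the factor 2 leaves room for [d] itself to be one
   of the variables. *)
Definition quot_le P d v r m f :=
  exists2 g, poly_le v r (m + m) g & P (d ^+ m * f - g).

Lemma quot_leC P d v r c : is_ideal P -> quot_le P d v r 0 c%:A.
Proof. by case=> P0 _ _; exists c%:A; [apply: poly_leC | rewrite mul1r subrr]. Qed.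

Lemma quot_leM P d v r m m' f g : is_ideal P ->
  quot_le P d v r m f -> quot_le P d v r m' g -> quot_le P d v r (m + m') (f * g).
Proof.
move=> iP [f' lef Pf] [g' leg Pg]; exists (f' * g').
  by rewrite addnACA; apply: poly_leM.
have -> : d ^+ (m + m') * (f * g) - f' * g' =
    (d ^+ m' * g) * (d ^+ m * f - f') + f' * (d ^+ m' * g - g').
  rewrite exprD mulrACA !mulrBr addrA; congr (_ - _).
  by rewrite [_ * (_ * f)]mulrC [f' * _]mulrC subrK.
by case: iP => _ PD PM; apply: PD; apply: PM.
Qed.

Lemma quot_leD P d v r m f g : is_ideal P ->
  quot_le P d v r m f -> quot_le P d v r m g -> quot_le P d v r m (f + g).
Proof.
move=> [_ PD _] [f' lef Pf] [g' leg Pg]; exists (f' + g'); first exact: poly_leD.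
by rewrite mulrDr opprD addrACA; apply: PD.
Qed.

Lemma quot_leS P d v r m m' f : is_ideal P -> poly_le v r 1 d ->
  (m <= m')%N -> quot_le P d v r m f -> quot_le P d v r m' f.
Proof.
move=> iP led /subnK <-; elim: (m' - m)%N => [//|n IHn] /IHn [g leg Pg].
exists (d * g).
  (* One more power of [d] raises the allowed degree by two: [d] uses one unit, a dummy factor [1]
     the other. *)
  have -> : (n.+1 + m + (n.+1 + m) = (1 + 0) + (1 + (n + m + (n + m))))%N.
    by rewrite !addSn !addnS.
  by rewrite -[d * g]mul1r -{1}[1]mulr1; do 2!apply: poly_leM => //; apply: poly_le1.
by rewrite exprS -mulrA -mulrBr; case: iP => _ _; apply.
Qed.

Lemma quot_le_div P d v r m n f g : is_ideal P -> quot_le P d v r m g ->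
  P (d ^+ n * f - g) -> quot_le P d v r (m + n) f.
Proof.
move=> [_ PD PM] [h leh Ph] Pfg; exists h.
  by rewrite -[h]mulr1 addnACA; apply: poly_leM => //; apply: poly_le1.
have -> : d ^+ (m + n) * f - h = d ^+ m * (d ^+ n * f - g) + (d ^+ m * g - h).
  by rewrite mulrBr addrA subrK exprD mulrA.
by apply: PD => //; apply: PM.
Qed.

Lemma quot_le_var P d v r i : is_ideal P -> poly_le v r 1 d -> (i < r)%N ->
  quot_le P d v r 1 (v i).
Proof.
move=> [P0 _ _] led ltir; exists (d * v i); last by rewrite subrr.
exact/(poly_leM led)/poly_le_var.
Qed.

(** The point is that the bound is linear in [n], as the count in [indep_mod_bound] requires. *)
Lemma quot_le_monom P d v r a m n s (e : expo n s) : is_ideal P -> poly_le v r 1 d ->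
  (forall i, (i < s)%N -> quot_le P d v r m (a i)) ->
  quot_le P d v r (s * (n * m)) (monom a e).
Proof.
move=> iP led; elim: s e => [|s IHs] /= e lea.
  by rewrite -[X in quot_le _ _ _ _ _ X]scale1r; apply: quot_leC.
case: e => i e /=; rewrite mulSn; apply: quot_leM => //; last first.
  by apply: IHs => j ltjs; apply/lea/ltnW.
apply: (@quot_leS _ _ _ _ (i * m)) => //.
  by rewrite leq_mul2r -ltnS ltn_ord orbT.
elim: (i : nat) => [|j IHj].
  by rewrite -[X in quot_le _ _ _ _ _ X]scale1r; apply: quot_leC.
by rewrite exprS mulSn; apply: quot_leM => //; apply: lea.
Qed.

(* Counting dimensions: the [(N+1)^(r+1)] monomials in [a] of degree at most [N]
   lie, up to a power of [d], in a space of dimension [O(N^r)]. *)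
Lemma indep_mod_bound P d v r a : is_prime P -> ~ P d -> poly_le v r 1 d ->
  (forall f, exists m, quot_le P d v r m f) -> ~ indep_mod P a r.+1.
Proof.
move=> prP Pd led genP ind_a; have [iP P1 PM] := prP.
have [D leD] : exists D, forall i, (i < r.+1)%N -> quot_le P d v r D (a i).
  elim: (r.+1) => [|s [D leD]]; first by exists 0%N.
  have [m lem] := genP (a s); exists (maxn D m) => i; rewrite ltnS leq_eqVlt.
  case/orP=> [/eqP-> | /leD leDi].
    exact: quot_leS (leq_maxr _ _) lem.
  exact: quot_leS (leq_maxl _ _) leDi.
(* With [m] below, [m + m = N * (C - 1)], so the target is spanned by at most
   [(C * N.+1) ^ r = N * N.+1 ^ r] monomials, fewer than the [N.+1 ^ r.+1] monomials in [a]. *)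
pose C := (r.+1 * D + r.+1 * D).+1; pose N := (C ^ r)%N.
pose m := (r.+1 * (N * D))%N.
have lem (e : expo N r.+1) : exists c : expo (m + m) r -> k,
    P (d ^+ m * monom a e - \sum_e' c e' *: monom v e').
  by have [_ [c ->] Pc] := quot_le_monom e iP led leD; exists c.
have [c Pc] := fin_all_exists lem.
have [|b [[e be] Pb]] := linear_relation_mod iP _ Pc.
  rewrite !card_expo.
  apply: (@leq_ltn_trans ((C * N.+1) ^ r)).
    have leC : ((m + m).+1 <= C * N.+1)%N.
      have -> : (m + m = N * (r.+1 * D + r.+1 * D))%N.
        by rewrite /m mulnCA -mulnDr.
      rewrite /C [X in (_ <= X)%N]mulSn addSn ltnS mulnC.
      by apply: leq_trans (leq_addl _ _); rewrite leq_mul2l leqnSn orbT.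
    by case: (r) => // s; rewrite leq_exp2r.
  by rewrite expnMn expnS ltn_mul2r expn_gt0 /= ltnS /N.
suff /ind_a/(_ e) b0 : P (\sum_e b e *: monom a e) by rewrite b0 eqxx in be.
have : P (d ^+ m * \sum_e b e *: monom a e).
  by rewrite mulr_sumr; under eq_bigr do rewrite -scalerAr.
by case/PM => // /(prime_exp prP).
Qed.

(** * Independent elements from a chain of primes *)

Lemma indep_mod0 P v : is_prime P -> indep_mod P v 0.
Proof.
move=> [[_ _ PM] P1 _] m c; rewrite (big_pred1 tt) => [|[] //] Pc [].
apply/eqP/negPn/negP=> c0.
apply: P1; have := PM (c tt)^-1%:A _ Pc.
by rewrite -scalerAl mul1r scalerA mulVf ?scale1r.
Qed.

(** A relation modulo [P] is a polynomial in [b] whose coefficients are polynomials in the [v i].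
    Independence modulo [Q] makes each coefficient lying in [Q] zero, which is what
    [horner_prime_eq0] needs. *)
Lemma indep_mod_extend P Q v r b : is_prime P -> is_prime Q -> subset_pred P Q ->
  Q b -> ~ P b -> indep_mod Q v r ->
  indep_mod P (fun i => if i == r then b else v i) r.+1.
Proof.
move=> prP [iQ _ _] PQ Qb Pb indv m c.
set v' := (fun i => if i == r then b else v i).
pose g (i : 'I_m.+1) := \sum_e c (i, e) *: monom v e.
have -> : \sum_e c e *: monom v' e = (\poly_(i < m.+1) g (inord i)).[b].
  have -> : \sum_e c e *: monom v' e =
      \sum_(i < m.+1) \sum_(e : expo m r) c (i, e) *: monom v' (r := r.+1) (i, e).
    by rewrite pair_bigA; apply: eq_bigr => -[].
  rewrite horner_poly.
  apply: eq_bigr => i _; rewrite inord_val mulr_suml; apply: eq_bigr => e _.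
  rewrite /= {1}/v' eqxx -scalerAl mulrC; congr (_ *: (_ * _)).
  by apply: eq_monom => j ltjr; rewrite /v' ltn_eqF.
have g0 i : Q (g i) -> forall e, c (i, e) = 0 by apply: indv.
move=> Pgb [i e]; apply: (g0).
suff /polyP/(_ i) : \poly_(i < m.+1) g (inord i) = 0.
  by rewrite coef_poly ltn_ord inord_val coef0 => ->; case: iQ.
apply: (horner_prime_eq0 prP iQ PQ Qb Pb _ Pgb) => j.
rewrite coef_poly; case: ifP => // _ Qgj.
by apply: big1 => e' _; rewrite g0 ?scale0r.
Qed.

(** Induction on the chain without its smallest prime; an element of [P 1] outside [P 0] is the new
    independent element. *)
Lemma chain_indep_mod (J : R -> Prop) n (P : nat -> R -> Prop) :
  prime_chain_quot J n P -> exists v, indep_mod (P 0%N) v n.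
Proof.
elim: n P => [|n IHn] P [prP ltP].
  by exists (fun=> 0); apply: indep_mod0; have [] := prP 0%N isT.
have [|v indv] := IHn (fun i => P i.+1).
  by split=> i lei; [apply: prP | apply: ltP].
have [P01 [b [P1b P0b]]] := ltP 0%N isT.
have [[prP0 _] [prP1 _]] := (prP 0%N isT, prP 1%N isT).
by exists (fun i => if i == n then b else v i); apply: indep_mod_extend indv.
Qed.

End Independence.

(** * Polynomial rings in arbitrarily many variables *)

Section PolynomialRing.
Variables (k : fieldType) (I : choiceType).

(** Variables are peeled off each monomial one at a time, by induction on its degree. *)
Lemma malg_ind (A : {malg k[{cmonom I}]} -> Prop) :
  (forall c, A c%:A) -> (forall i, A << ucm i >>) ->
  (forall f g, A f -> A g -> A (f + g)) -> (forall f g, A f -> A g -> A (f * g)) ->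
  forall f, A f.
Proof.
move=> AC AU AD AM f; rewrite (monalgE f).
apply: big_ind => // [|m _]; first by rewrite -(scale0r 1).
have -> : << f@_m *g m >> = (f@_m)%:A * << m >> :> {malg k[{cmonom I}]}.
  apply/malgP => m'; rewrite mulr_algl mcoeffZ [LHS]mcoeffU.
  by rewrite [X in _ = _ * X]mcoeffU mulr_natr.
apply: (AM) => //; elim: {m}(mdeg m) {-2}m (erefl (mdeg m)) => [|n IHn] m degm.
  by rewrite (mdeg_eq0I degm) -[<< _ >>]scale1r; apply: AC.
have [i mi] : exists i, m i != 0%N.
  have [m0|[i im]] := fset_0Vmem (finsupp m); last by exists i; rewrite cmE_neq0.
  by rewrite mdegE m0 big_seq_fset0 in degm.
have def_m : m = mmul (ucm i) (divcm m (ucm i)).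
  apply/eqP/cmP => j; rewrite cmM divcmE ucmE subnKC //.
  by case: eqVneq => // <-; rewrite lt0n.
rewrite def_m -[X in << X *g _ >>](mulr1 (1 : k)) -fgmulUU -malgM_def.
apply: AM => //; apply: IHn.
by move: degm; rewrite {1}def_m mdegM mdegU => -[].
Qed.

Lemma malg_eval (S : comRingType) (f : {rmorphism k -> S}) (w : I -> S) :
  exists phi : {rmorphism {malg k[{cmonom I}]} -> S},
    (forall c, phi c%:A = f c) /\ (forall i, phi << ucm i >> = w i).
Proof.
pose h (m : {cmonom I}) := \prod_(i <- finsupp m) w i ^+ m i.
(* The product may run over any finite set containing the support, so the values at [m1], [m2] and
   their product can be compared over one set. *)
have hEw (m : {cmonom I}) (d : {fset I}) : (finsupp m `<=` d)%fset ->
    h m = \prod_(i <- d) w i ^+ m i.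
  move=> le; rewrite /h (big_fset_incl _ le) // => i _.
  by rewrite -cmE_neq0 negbK => /eqP->.
have hM : mmorphism h.
  split=> [m1 m2|]; last by rewrite /h mdom1 big_seq_fset0.
  rewrite {1}/h mdomD (hEw m1 _ (fsubsetUl _ (finsupp m2))).
  rewrite (hEw m2 _ (fsubsetUr (finsupp m1) _)) -big_split /=.
  by apply: eq_bigr => i _; rewrite cmM exprD.
pose hC := isMultiplicative.Build _ _ h hM.
pose H : {mmorphism {cmonom I} -> S} := HB.pack h hC.
exists (mmap f H : {rmorphism _ -> _}); split=> [c|i].
  by rewrite -[LHS]/(mmap f H (c *: 1)) mmapZ mmap1 mulr1.
rewrite -[LHS]/(mmap f H << ucm i >>) mmapU -[LHS]/(f 1 * h (ucm i)).
by rewrite rmorph1 mul1r /h mdomU big_seq_fset1 ucmE eqxx.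
Qed.

End PolynomialRing.

(** * Kernels, the relations and their solution over a field *)

Lemma prime_kernel (R : comRingType) (S : idomainType) (phi : {rmorphism R -> S}) :
  is_prime (fun x => phi x = 0).
Proof.
split=> [||x y]; first split=> [|x y|r x].
- exact: rmorph0.
- by rewrite rmorphD => -> ->; rewrite addr0.
- by rewrite rmorphM => ->; rewrite mulr0.
- by rewrite rmorph1; apply/eqP/oner_neq0.
- by rewrite rmorphM => /eqP; rewrite mulf_eq0 => /orP[]/eqP; [left | right].
Qed.

(** Over an arbitrary ring, to serve both for [rel_Omega] in [Lambda] and for the images of the
    variables in [{poly {poly F}}]. *)
Definition omega_rel (R : comRingType) (x : R) (z : nat -> R) i :=
  x ^+ (2 ^ i) * z i.+1 + z i + z i.-1 ^+ 2.

(** Generation as a [k]-algebra, phrased as an induction principle so that [R] can stay abstract. *)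
Definition generated_by (k : fieldType) (R : comAlgType k) (x : R) (z : nat -> R) :=
  forall A : R -> Prop,
    (forall c : k, A c%:A) -> A x -> (forall i, A (z i)) ->
    (forall f g, A f -> A g -> A (f + g)) -> (forall f g, A f -> A g -> A (f * g)) ->
  forall f, A f.

(* The consecutive pairs (z_n, z_(n+1)) as polynomials in s = z_0 and t = z_1 over
   a field where [a = x] is invertible. *)
Fixpoint z_pair (F : fieldType) (a : F) n : {poly {poly F}} * {poly {poly F}} :=
  if n is n'.+1 then
    let: (u, w) := z_pair a n' in (w, - ((a ^- (2 ^ n))%:P%:P * (w + u ^+ 2)))
  else ('X, 'X%:P).

Lemma rel_z_pair (F : fieldType) (a : F) i : a != 0 ->
  omega_rel a%:P%:P (fun n => (z_pair a n).1) i.+1 = 0.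
Proof.
move=> a_neq0; rewrite /omega_rel /=; case: (z_pair a i) => u w /=.
rewrite mulrN mulrA -!polyC_exp -!polyCM mulfV ?expf_neq0 // mul1r.
by rewrite -addrA addNr.
Qed.

(** * The ring [Omega]: upper bound for the dimension *)

Section Omega.
Variables (k : fieldType) (R : comAlgType k) (x : R) (z : nat -> R).
Hypothesis genR : generated_by x z.
Implicit Types (A P Q : R -> Prop) (f g : R) (i j n : nat).

Definition coords i : R := match i with 0 => x | 1 => z 0 | _ => z 1 end.

(** The denominator [d] is [1] if [x] lies in [P] and [x] otherwise. Either way a power of [d] times
    [z i.+2] is congruent to a polynomial in [z i.+1] and [z i], so the bounds propagate along the
    sequence. *)
Lemma quot_le_Omega P : is_prime P -> (forall i, P (omega_rel x z i.+1)) ->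
  exists d, [/\ ~ P d, poly_le coords 3 1 d &
    forall f, exists m, quot_le P d coords 3 m f].
Proof.
move=> [iP P1 PM] Prel; have [_ PD PMl] := iP.
have [d [Pd led Zd]] : exists d, [/\ ~ P d, poly_le coords 3 1 d &
    forall i, exists e w, P (d ^+ e * z i.+2 - w) /\
      forall m, quot_le P d coords 3 m (z i.+1) ->
                quot_le P d coords 3 m (z i) ->
      exists m', quot_le P d coords 3 m' w].
  have [PX|PX] := classic (P x).
    exists 1; split; [by [] | exact: poly_le1 |] => i.
    (* Modulo [x], the relation of index [i.+2] gives [z i.+2 = - z i.+1 ^+ 2]. *)
    exists 0%N, (- (1)%:A * (z i.+1 * z i.+1)); split.
      have -> : 1 ^+ 0 * z i.+2 - - (1)%:A * (z i.+1 * z i.+1) =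
          omega_rel x z i.+2 - z i.+3 * x ^+ (2 ^ i.+2).-1 * x.
        rewrite /omega_rel scale1r mulNr !mul1r opprK -mulrA -exprSr prednK ?expn_gt0 //.
        rewrite [z i.+3 * _]mulrC -[X in _ = X - _]addrA.
        by rewrite [X in _ = X - _]addrC addrK expr2.
      by apply: idealB => //; apply: PMl.
    move=> m le1 _; exists (0 + (m + m))%N; rewrite -scaleNr.
    by do ![apply: quot_leM => //]; apply: quot_leC.
  have lex : poly_le coords 3 1 x by apply: (@poly_le_var _ _ coords 3 0 0).
  exists x; split=> // i.
  (* This is the relation of index [i.+1], solved for its leading term. *)
  exists (2 ^ i.+1)%N, ((- 1)%:A * (z i.+1 + z i * z i)); split.
    by rewrite scaleN1r mulN1r opprK addrA -[z i * z i]expr2; apply: Prel.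
  move=> m le1 le0; exists (0 + (m + m))%N.
  apply: quot_leM => //; first exact: quot_leC.
  apply: quot_leD => //; last exact: quot_leM.
  by apply: quot_leS le1 => //; apply: leq_addr.
exists d; split=> //.
have var i : (i < 3)%N -> exists m, quot_le P d coords 3 m (coords i).
  by move=> lti; exists 1%N; apply: quot_le_var.
have max2 f g : (exists m, quot_le P d coords 3 m f) ->
    (exists m, quot_le P d coords 3 m g) ->
    exists m, quot_le P d coords 3 m f /\ quot_le P d coords 3 m g.
  move=> [m lef] [m' leg]; exists (m + m')%N; split.
    by apply: quot_leS lef => //; apply: leq_addr.
  by apply: quot_leS leg => //; apply: leq_addl.
apply: genR => [c||i|f g lef leg|f g [m lef] [m' leg]].
- by exists 0%N; apply: quot_leC.
- exact: (var 0%N).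
- suff [] : (exists m, quot_le P d coords 3 m (z i)) /\
      (exists m, quot_le P d coords 3 m (z i.+1)) by [].
  elim: i => [|i [lei leSi]]; first by split; [apply: (var 1%N) | apply: (var 2%N)].
  split=> //; have [m [lei' leSi']] := max2 _ _ lei leSi.
  have [e [w [Pw quot_w]]] := Zd i; have [m' lew] := quot_w m leSi' lei'.
  by exists (m' + e)%N; apply: quot_le_div Pw.
- by have [m [lef' leg']] := max2 _ _ lef leg; exists m; apply: quot_leD.
- by exists (m + m')%N; apply: quot_leM.
Qed.


Local Notation J := (ideal_gen (fun f => exists i, (1 <= i)%N /\ f = omega_rel x z i)).
Local Notation M := (ideal_gen (fun f => (exists i, (1 <= i)%N /\ f = omega_rel x z i)
                                         \/ f = x \/ f = z 0)).

Lemma J_rel i : J (omega_rel x z i.+1).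
Proof. by apply: sub_ideal_gen; exists i.+1. Qed.

Lemma J_sub A : is_ideal A -> (forall i, A (omega_rel x z i.+1)) -> subset_pred J A.
Proof. by move=> iA Arel; apply: (ideal_gen_sub iA) => _ [[|i] [// _ ->]]. Qed.

Lemma M_rel i : M (omega_rel x z i.+1).
Proof. by apply: sub_ideal_gen; left; exists i.+1. Qed.

Lemma M_x : M x.
Proof. by apply: sub_ideal_gen; right; left. Qed.

Lemma M_z0 : M (z 0).
Proof. by apply: sub_ideal_gen; right; right. Qed.

Lemma M_sub A : is_ideal A -> (forall i, A (omega_rel x z i.+1)) -> A x -> A (z 0) ->
  subset_pred M A.
Proof.
by move=> iA Arel Ax Az; apply: (ideal_gen_sub iA) => _ [[[|i] [// _ ->]]|[->|->]].
Qed.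

Lemma no_chain4 (P : nat -> R -> Prop) : ~ prime_chain_quot J 4 P.
Proof.
move=> chP; have [v indv] := chain_indep_mod chP.
have [prP0 _] := chP; have [pr J0] := prP0 0%N isT.
have [|d [Pd led leP]] := quot_le_Omega pr; first by move=> i; apply: J0; apply: J_rel.
exact: (indep_mod_bound pr Pd led leP indv).
Qed.

(** * Specialisations of [Omega] and the chain of kernels *)

Local Notation K := {fraction {poly k}}.
Local Notation tofrac := (@FracField.tofrac {poly k}).
Local Notation "p %:F" := (tofrac p).
Local Notation xi := ('X%:F : K).

(** In the target the outer variable stands for [z 0] and the inner one for [z 1]. *)
Variable sigma : {rmorphism R -> {poly {poly K}}}.
Hypotheses (sigmaC : forall c, sigma c%:A = c%:P%:F%:P%:P)
  (sigma_x : sigma x = xi%:P%:P) (sigma_z : forall i, sigma (z i) = (z_pair xi i).1).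

(** Evaluation at the origin: its kernel is a prime above [M], which ends the chain for the
    dimension and witnesses the upper bound for the height. *)
Variable eps : {rmorphism R -> k}.
Hypotheses (eps_x : eps x = 0) (eps_z : forall i, eps (z i) = 0).

Lemma xi_neq0 : xi != 0.
Proof. by rewrite tofrac_eq0 polyX_eq0. Qed.

Lemma sigma_rel i : sigma (omega_rel x z i.+1) = 0.
Proof.
rewrite -(rel_z_pair i xi_neq0) /omega_rel !rmorphD rmorphM !rmorphXn sigma_x.
by rewrite !sigma_z.
Qed.

Let tau : {rmorphism R -> {poly K}} := horner_eval 0 \o sigma.
Let tau0 : {rmorphism R -> K} := horner_eval 0 \o tau.

Lemma tauE f : tau f = (sigma f).[0]. Proof. by []. Qed.
Lemma tau0E f : tau0 f = (tau f)`_0. Proof. by rewrite -horner_coef0. Qed.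

Lemma tau_x : tau x = xi%:P.
Proof. by rewrite tauE sigma_x hornerC. Qed.

Lemma tau0_x : tau0 x = xi.
Proof. by rewrite tau0E tau_x coefC. Qed.

Lemma tau_zSS i :
  tau (z i.+2) = (- xi ^- (2 ^ i.+1))%:P * (tau (z i.+1) + tau (z i) ^+ 2).
Proof.
have : tau (omega_rel x z i.+1) = 0 by rewrite tauE sigma_rel horner0.
rewrite /omega_rel !rmorphD rmorphM !rmorphXn -addrA => /eqP.
rewrite addr_eq0 polyCN mulNr -mulrN => /eqP <-.
rewrite tau_x mulrA -polyC_exp -polyCM mulVf ?mul1r //.
by rewrite expf_neq0 // xi_neq0.
Qed.

Lemma tau0_z i : tau0 (z i) = 0.
Proof.
suff [] : tau0 (z i) = 0 /\ tau0 (z i.+1) = 0 by [].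
elim: i => [|i [z0 z1]]; split=> //.
- by rewrite tau0E tauE sigma_z hornerX coef0.
- by rewrite tau0E tauE sigma_z hornerC coefX.
- move: z0 z1; rewrite !tau0E tau_zSS coefCM coefD expr2 coef0M => -> ->.
  by rewrite mul0r addr0 mulr0.
Qed.

(** Since [tau0 (z i) = 0], the square in [tau_zSS] has no linear term, so each step multiplies the
    linear coefficient by [- xi ^- (2 ^ i.+1)]. Only the growth of [e] matters later. *)
Lemma tau1_z i : exists e b, (i <= e)%N /\ (tau (z i.+1))`_1 = (-1) ^+ b * xi ^- e.
Proof.
elim: i => [|i [e [b [le_ie tau1]]]].
  by exists 0%N, 0%N; rewrite tauE sigma_z hornerC coefX expr0 invr1 mulr1.
exists (2 ^ i.+1 + e)%N, b.+1; split.
  by rewrite -add1n leq_add // expn_gt0.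
rewrite tau_zSS coefCM coefD expr2 coefM big_ord_recl big_ord1 /= -tau0E tau0_z.
rewrite mul0r mulr0 !addr0 tau1 exprD invfM exprS.
by rewrite mulN1r !mulNr mulrCA.
Qed.

(** Modulo [x] the relations read [z i.+1 = - z i ^+ 2], so membership spreads from [z 0]. *)
Lemma ideal_z A : is_ideal A -> (forall i, A (omega_rel x z i.+1)) -> A x -> A (z 0) ->
  forall i, A (z i).
Proof.
move=> iA Arel Ax Az0; have [_ AD AM] := iA; elim=> [//|i IHi].
apply: (@idealDr _ A _ (x ^+ (2 ^ i.+1) * z i.+2 + z i ^+ 2)) => //.
  apply: AD; last by rewrite expr2; apply: AM.
  by rewrite mulrC -(prednK (expn_gt0 2 i.+1)) exprSr mulrA; apply: AM.
by rewrite addrCA addrA; apply: Arel.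
Qed.

(** All [z i] vanish under [tau0], so its values have no denominators. Tying [f] to [q.[0]] puts the
    kernel of [tau0] inside every prime above [M], the last inclusion of the chain. *)
Lemma tau0_poly f : exists q : {poly k}, tau0 f = q%:F /\
  forall A, is_ideal A -> (forall i, A (omega_rel x z i.+1)) -> A x -> A (z 0) ->
    A (f - (q.[0])%:A).
Proof.
move: f; apply: genR =>
  [c||i|f g [p [fp Afp]] [q [gq Agq]]|f g [p [fp Afp]] [q [gq Agq]]].
- exists c%:P; rewrite tau0E tauE sigmaC !hornerC coefC; split=> // A [A0 _ _].
  by rewrite subrr.
- by exists 'X; rewrite tau0_x; split=> // A iA _ Ax _; rewrite hornerX scale0r subr0.
- exists 0; rewrite tau0_z tofrac0; split=> // A iA Arel Ax Az.
  by rewrite horner0 scale0r subr0; apply: ideal_z.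
- exists (p + q); rewrite rmorphD fp gq tofracD; split=> // A iA Arel Ax Az.
  rewrite hornerD scalerDl opprD addrACA; case: (iA) => _ AD _.
  by apply: AD; [apply: Afp | apply: Agq].
- exists (p * q); rewrite rmorphM fp gq tofracM; split=> // A iA Arel Ax Az.
  have -> : f * g - (p * q).[0]%:A = g * (f - p.[0]%:A) + p.[0]%:A * (g - q.[0]%:A).
    rewrite !mulrBr addrA [g * f]mulrC [g * _]mulrC subrK hornerM.
    by rewrite -scalerAl mul1r scalerA.
  by case: (iA) => _ AD AM; apply: AD; apply: AM; [apply: Afp | apply: Agq].
Qed.

Definition kernels (Q : R -> Prop) i : R -> Prop :=
  match i with
  | 0 => fun f => sigma f = 0
  | 1 => fun f => tau f = 0
  | 2 => fun f => tau0 f = 0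
  | _ => Q
  end.

Lemma kernels_chain Q : is_prime_quot J Q -> subset_pred M Q ->
  prime_chain_quot J 3 (kernels Q).
Proof.
move=> prQ MQ.
have pr0 : is_prime_quot J (fun f => sigma f = 0).
  split; first exact: prime_kernel.
  by apply: J_sub => [|i]; [case: (prime_kernel sigma) | apply: sigma_rel].
have pr1 : is_prime_quot J (fun f => tau f = 0).
  split; first exact: prime_kernel.
  apply: J_sub => [|i]; first by case: (prime_kernel tau).
  by rewrite tauE sigma_rel horner0.
have pr2 : is_prime_quot J (fun f => tau0 f = 0).
  split; first exact: prime_kernel.
  apply: J_sub => [|i]; first by case: (prime_kernel tau0).
  by rewrite tau0E tauE sigma_rel horner0 coef0.
have sub01 f : sigma f = 0 -> tau f = 0 by rewrite tauE => ->; rewrite horner0.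
have sub12 f : tau f = 0 -> tau0 f = 0 by rewrite tau0E => ->; rewrite coef0.
have sub2Q f : tau0 f = 0 -> Q f.
  have [q [-> Qf]] := tau0_poly f => /eqP; rewrite tofrac_eq0 => /eqP q0.
  have [[iQ _ _] _] := prQ.
  move: Qf; rewrite q0 horner0 scale0r subr0; apply=> [//|i||]; apply: MQ.
  - exact: M_rel.
  - exact: M_x.
  - exact: M_z0.
split; first by case=> [|[|[|[|i]]]].
case=> [|[|[|//]]] _.
- split=> //; exists (z 0); split; first by rewrite /kernels tauE sigma_z hornerX.
  by rewrite /kernels sigma_z => /eqP; rewrite polyX_eq0.
- split=> //; exists (z 1); split; first exact: tau0_z.
  by rewrite /kernels tauE sigma_z hornerC => /eqP; rewrite polyX_eq0.
- split=> //; exists x; split; first by apply: MQ; apply: M_x.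
  by rewrite /kernels tau0_x; apply/eqP/xi_neq0.
Qed.

Lemma ker_eps_prime : is_prime_quot J (fun f => eps f = 0) /\
  subset_pred M (fun f => eps f = 0).
Proof.
have prE := prime_kernel eps; have [iE _ _] := prE.
have E_rel i : eps (omega_rel x z i.+1) = 0.
  by rewrite /omega_rel !rmorphD rmorphM !rmorphXn /= !eps_z mulr0 expr2 mul0r !addr0.
by split; [split=> //; apply: J_sub | apply: M_sub].
Qed.

Lemma dim_Omega : krull_dim_quot J 3.
Proof.
have [prE ME] := ker_eps_prime; split; last by case=> P /no_chain4.
by exists (kernels (fun f => eps f = 0)); apply: kernels_chain.
Qed.

Lemma height_Omega : ideal_height_quot J M 3.
Proof.
split=> [Q prQ MQ|]; first by exists (kernels Q); split=> //; apply: kernels_chain.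
have [prE ME] := ker_eps_prime; exists (fun f => eps f = 0); split=> //.
by case=> P [/no_chain4].
Qed.

(** * Poles at [x = 0] and the failure of the ascending chain condition *)

Definition pole_ideal n f :=
  tau0 f = 0 /\ exists q : {poly k}, xi ^+ n * (tau f)`_1 = q%:F.

(** When [tau0 f = 0], the linear coefficient of [tau (r * f)] is [tau0 r] times that of [tau f],
    and [tau0 r] is a polynomial by [tau0_poly], so the pole does not get worse. *)
Lemma pole_idealP n : is_ideal (pole_ideal n) /\ subset_pred J (pole_ideal n).
Proof.
suff iA : is_ideal (pole_ideal n).
  split=> //; apply: J_sub => // i; split.
    by rewrite tau0E tauE sigma_rel horner0 coef0.
  by exists 0; rewrite tauE sigma_rel horner0 coef0 mulr0 tofrac0.
split=> [|f g [f0 [p fp]] [g0 [q gq]]|r f [f0 [p fp]]].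
- by split; [rewrite rmorph0 | exists 0; rewrite rmorph0 coef0 mulr0 tofrac0].
- split; first by rewrite rmorphD f0 g0 addr0.
  by exists (p + q); rewrite rmorphD coefD mulrDr fp gq tofracD.
- split; first by rewrite rmorphM f0 mulr0.
  have [q [rq _]] := tau0_poly r; exists (q * p).
  rewrite rmorphM coefM big_ord_recl big_ord1 /= -!tau0E f0 mulr0 addr0.
  by rewrite mulrCA fp rq tofracM.
Qed.

Lemma not_noetherian_Omega : ~ noetherian_quot J.
Proof.
move=> /(_ pole_ideal pole_idealP) [n f [f0 [p fp]]|N stable].
  by split=> //; exists ('X * p); rewrite exprS -mulrA fp tofracM.
(* The linear coefficient of [z N.+2] has a pole of order exactly [e > N], so this element separates
   [pole_ideal e] from [pole_ideal N]. *)
have [e [b [ltNe tau1]]] := tau1_z N.+1.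
have xi_n0 i : xi ^+ i != 0 by rewrite expf_neq0 ?xi_neq0.
have : pole_ideal e (z N.+2).
  split; first exact: tau0_z.
  exists ((-1) ^+ b); rewrite tau1 mulrCA (mulfV (xi_n0 e)) mulr1.
  by rewrite rmorph_sign.
case/(stable e (ltnW ltNe)) => _ [q]; rewrite tau1 mulrA => /(canRL (mulfVK (xi_n0 e))).
rewrite -!rmorphXn -[(-1) ^+ b](rmorph_sign tofrac) -!tofracM => /eqP.
rewrite tofrac_eq => /eqP.
(* Clearing denominators equates ['X ^+ N], up to sign, with a multiple of ['X ^+ e]; the
   coefficients at [N] are then a sign and zero. *)
move=> /polyP/(_ N); rewrite coefMXn ltNe mulrC -signr_odd mulr_sign.
by case: ifP => _; rewrite ?coefN coefXn eqxx => /eqP; rewrite ?oppr_eq0 oner_eq0.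
Qed.

End Omega.

(** * The polynomial ring [Lambda] and its evaluation maps *)

Lemma generated_by_Lambda (k : fieldType) :
  @generated_by k {malg k[{cmonom (option nat)}]} (varX k) (varZ k).
Proof.
move=> A Ac Ax Az Ad Am; apply: (@malg_ind k _ A Ac _ Ad Am).
by case=> [i|]; [apply: Az | apply: Ax].
Qed.

Lemma Lambda_sigma (k : fieldType) (K := {fraction {poly k}})
    (xi := FracField.tofrac 'X : K) :
  exists sigma : {rmorphism {malg k[{cmonom (option nat)}]} -> {poly {poly K}}},
    [/\ forall c, sigma c%:A = (FracField.tofrac c%:P)%:P%:P, sigma (varX k) = xi%:P%:P
      & forall i, sigma (varZ k i) = (z_pair xi i).1].
Proof.
pose w (v : option nat) := if v is Some i then (z_pair xi i).1 else xi%:P%:P.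
pose f : {rmorphism k -> {poly {poly K}}} :=
  polyC \o (polyC \o ((@FracField.tofrac {poly k}) \o polyC)).
have [sigma [sigmaC sigmaU]] := malg_eval f w.
exists sigma; split=> [c||i].
- exact: sigmaC.
- exact: (sigmaU None).
exact: (sigmaU (Some i)).
Qed.

Lemma Lambda_eps (k : fieldType) :
  exists eps : {rmorphism {malg k[{cmonom (option nat)}]} -> k},
    eps (varX k) = 0 /\ forall i, eps (varZ k i) = 0.
Proof.
have [eps [_ epsU]] := malg_eval idfun (fun _ : option nat => 0 : k).
by exists eps; split=> [|i]; apply: epsU.
Qed.

Theorem theorem4p11 (k : fieldType) :
  krull_dim_quot (J_Omega k) 3 /\
  ideal_height_quot (J_Omega k) (m_Omega k) 3 /\
  ~ noetherian_quot (J_Omega k).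
Proof.
have [sigma [sigmaC sigma_x sigma_z]] := Lambda_sigma k.
have [eps [eps_x eps_z]] := Lambda_eps k.
have genL := @generated_by_Lambda k.
split; last split.
- exact: (dim_Omega genL sigmaC sigma_x sigma_z eps_x eps_z).
- exact: (height_Omega genL sigmaC sigma_x sigma_z eps_x eps_z).
exact: (not_noetherian_Omega genL sigmaC sigma_x sigma_z).
Qed.
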